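(* Let $\Omega^\Gamma\in\Xi$ and suppose $\psi(\Omega^\Gamma)<0$. Then there is a unique steepest descent direction $\mathbf g\in\mathcal H(\Omega,\mathbb R^2)$, $\|\mathbf g\|_{\mathcal H}=1$, for $J_\infty(\cdot)$ at $\Omega^\Gamma$, given by $$\mathbf g:=-\frac{\hat Z}{\|\hat Z\|_{\mathcal H}},$$ where $\hat Z=P_{\bar L(\Omega^\Gamma)}(0)$ is the projection of $0$ (in $\mathcal H(\Omega,\mathbb R^2)$) onto $\bar L(\Omega^\Gamma)$.
   Context: Geometry. $D\subset\mathbb R^2$ is a fixed open bounded set. For $\Omega\subset\mathbb R^2$, $\Gamma\subset\partial\Omega$, the set $\Omega\cup\Gamma$ is regular (in the sense of Gröger) if $\Omega$ is a bounded Lipschitz domain, $\Gamma$ is relatively open in $\partial\Omega$, $\Gamma_0:=\partial\Omega\setminus\Gamma$ has positive measure, and $\Gamma_0$ is a finite union of closed and non-degenerate curved pieces of $\partial\Omega$. $\Xi:=\{(\Omega,\Gamma):\Omega\subset D,\ \Gamma\subset\partial\Omega,\ \Omega\cup\Gamma\text{ regular}\}$, $\Omega^\Gamma:=(\Omega,\Gamma)$. Spaces. $W^1_{\Gamma,p}(\Omega)$ is the closure in $W^1_p(\Omega)$ of $\{f|_\Omega:f\in C^\infty(\mathbb R^2),\ \operatorname{supp}f\cap\Gamma_0=\emptyset\}$, $W^{-1}_{\Gamma,p}(\Omega):=(W^1_{\Gamma,p'}(\Omega))^*$, $1/p+1/p'=1$. $Lu:=(u,\nabla u)^\top$. Data.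 $\beta\in C^1(\mathbb R)$ satisfies: $\bar\beta\le\beta\le\underline\beta$ for some constants $\bar\beta,\underline\beta>0$; $(\beta(x)-\beta(y))(x-y)\ge0$ for all $x,y\in\mathbb R$; there are $k,K>0$ with $k|\eta|^2\le\beta(|p|^2)|\eta|^2+2\beta'(|p|^2)|p\cdot\eta|^2\le K|\eta|^2$ for all $\eta,p\in\mathbb R^2$. $f\in W^1_q(D)$; $\Psi:\mathbb R^2\times\mathbb R\to\mathbb R$ is continuously differentiable, $\nabla_y\Psi$ being its gradient in the first variable and $\partial_\zeta\Psi$ its derivative in the second. Exponent. $2<q<q_0$, where $q_0>2$ is fixed as follows. Let $\langle\mathcal Jv,w\rangle:=\int_\Omega\nabla v\cdot\nabla w+vw\,dx$, $M_p:=\sup\{\|v\|_{W^1_p(\Omega)}:v\in W^1_{\Gamma,p}(\Omega),\ \|\mathcal Jv\|_{W^{-1}_{\Gamma,p}(\Omega)}\le1\}$ with $\|v\|_{W^1_p(\Omega)}=\|\,|Lv|\,\|_{L_p(\Omega)}$, and $\Omega^\Gamma\in R_p$ if $\mathcal J$ maps $W^1_{\Gamma,p}(\Omega)$ onto $W^{-1}_{\Gamma,p}(\Omega)$; then $q_0>2$ satisfies $\Omega^\Gamma\in R_{q_0}$ and $M_q(1-m^2/M^2)^{1/2}<1$ for all $q\in[2,q_0]$, where $m=\min\{k,1\}$, $M=\max\{K,1\}$. State, adjoint. $u\in W^1_{\Gamma,q}(\Omega)\subset C(\overline\Omega)$ is the unique solution of $\int_\Omega\beta(|\nabla u|^2)\nabla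 u\cdot\nabla\varphi+u\varphi\,dx=\int_\Omega f\varphi\,dx$ for all $\varphi\in W^1_{\Gamma,q'}(\Omega)$. With $a(x,\zeta):=(\zeta_0,\beta(|\hat\zeta|^2)\hat\zeta)^\top$ for $\zeta=(\zeta_0,\hat\zeta)\in\mathbb R^3$ and $b(x,u):=\partial_\zeta a(x,Lu(x))$, for $y\in\overline\Omega$ the adjoint state $p_y\in W^1_{\Gamma,q'}(\Omega)$ solves $\int_\Omega b(x,u)Lp_y\cdot L\varphi\,dx=-\partial_\zeta\Psi(y,u(y))\varphi(y)$ for all $\varphi\in W^1_{\Gamma,q}(\Omega)$. Derivatives. $J_\infty(\Omega^\Gamma):=\max_{x\in\overline\Omega}\Psi(x,u(x))$, $R(\Omega^\Gamma):=\{x\in\overline\Omega:\Psi(x,u(x))=J_\infty(\Omega^\Gamma)\}$. For $y\in\overline\Omega$, $$dj(\Omega^{\Gamma,y})(X)=\int_\Omega\mathbf S_1(u,p_y):\partial X+\mathbf S_0(u,p_y)\cdot X\,dx+X(y)\cdot\nabla_y\Psi(y,u(y)),$$ $\mathbf S_1(u,p)=(\beta(|\nabla u|^2)\nabla u\cdot\nabla p+up-fp)I-\beta(|\nabla u|^2)(\nabla u\otimes\nabla p+\nabla p\otimes\nabla u)-2\beta'(|\nabla u|^2)(\nabla u\cdot\nabla p)\nabla u\otimes\nabla u$, $\mathbf S_0(u,p)=-\nabla f\,p$. Hilbert space. $\mathcal H(\Omega,\mathbb R^2)$ is a fixed real Hilbert space with inner product $(\cdot,\cdot)_{\mathcal H}$,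 contained in the space $\mathring C^{0,1}(D,\mathbb R^2)$ of Lipschitz functions on $\overline D$ vanishing on $\partial D$, such that $X\mapsto a\cdot X(y)$ is continuous on it for all $a\in\mathbb R^2$ and all $y$. $\nabla j(\Omega^{\Gamma,y})\in\mathcal H(\Omega,\mathbb R^2)$ is the Riesz representative: $(\nabla j(\Omega^{\Gamma,y}),\varphi)_{\mathcal H}=dj(\Omega^{\Gamma,y})(\varphi)$ for all $\varphi\in\mathcal H(\Omega,\mathbb R^2)$. The Eulerian semi-derivative of $J_\infty$ is given on $\mathcal H(\Omega,\mathbb R^2)$ by $dJ_\infty(\Omega^\Gamma)(X)=\max_{y\in R(\Omega^\Gamma)}(\nabla j(\Omega^{\Gamma,y}),X)_{\mathcal H}$. $H(\Omega^\Gamma):=\{\nabla j(\Omega^{\Gamma,y}):y\in R(\Omega^\Gamma)\}$; $L(\Omega^\Gamma)$ is the convex hull of $H(\Omega^\Gamma)$ and $\bar L(\Omega^\Gamma)$ its closure in $\mathcal H(\Omega,\mathbb R^2)$. $\psi(\Omega^\Gamma):=\min_{X\in\mathcal H(\Omega,\mathbb R^2),\,\|X\|_{\mathcal H}=1}\ \max_{Z\in H(\Omega^\Gamma)}(Z,X)_{\mathcal H}$. A vector $\mathbf g\in\mathcal H(\Omega,\mathbb R^2)$ with $\|\mathbf g\|_{\mathcal H}=1$ is a steepest descent direction of $J_\infty$ at $\Omega^\Gamma$ if $dJ_\infty(\Omega^\Gamma)(\mathbf g)\le dJ_\infty(\Omega^\Gamma)(\varphi)$ for all $\varphi\in\mathcal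 H(\Omega,\mathbb R^2)$ with $\|\varphi\|_{\mathcal H}=1$. For a closed convex set $C$ in a Hilbert space, $P_C(x_0)$ is the unique point of $C$ closest to $x_0$. *)

(* Defs.v *)
From HB Require Import structures.
From mathcomp Require Import all_boot all_order all_algebra.
From mathcomp Require Import all_classical all_reals all_analysis.

Set Implicit Arguments.
Unset Strict Implicit.
Unset Printing Implicit Defensive.

Import Order.TTheory GRing.Theory Num.Theory numFieldNormedType.Exports.

Local Open Scope classical_set_scope.
Local Open Scope ring_scope.

(* The plane is [R * R].  Its library norm is the max norm (same topology,
   same Lipschitz functions); Euclidean lengths are written [enorm]. *)

Definition dot2 (R : realType) (x y : R * R) : R := x.1 * y.1 + x.2 * y.2.
Definition enorm (R : realType) (x : R * R) : R := Num.sqrt (dot2 x x).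

Definition dot3 (R : realType) (x y : R * (R * R)) : R :=
  x.1 * y.1 + dot2 x.2 y.2.
Definition enorm3 (R : realType) (x : R * (R * R)) : R := Num.sqrt (dot3 x x).

Definition coord2 (R : realType) (x : R * R) (i : 'I_2) : R :=
  if i == ord0 then x.1 else x.2.
Definition tensor (R : realType) (x y : R * R) : 'M[R]_2 :=
  \matrix_(i, j) (coord2 x i * coord2 y j).
Definition ddot (R : realType) (A B : 'M[R]_2) : R :=
  \sum_i \sum_j A i j * B i j.

Definition mu2 (R : realType) :
    {measure set (measurableTypeR R * measurableTypeR R) -> \bar R} :=
  (@lebesgue_measure R \x @lebesgue_measure R)%E.

(* In finite dimension [Ck n f] says that [f] is of class C^n. *)
Fixpoint Ck (R : realType) (V : normedModType R) (n : nat) (f : V -> R)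
    : Prop :=
  if n is m.+1 then
    (forall x, differentiable f x) /\ (forall v, Ck m (fun x => 'D_v f x))
  else continuous f.
Definition smooth (R : realType) (V : normedModType R) (f : V -> R) : Prop :=
  forall n, Ck n f.

Definition bd (T : topologicalType) (A : set T) : set T :=
  closure A `\` A°.
Definition supp (R : realType) (f : R * R -> R) : set (R * R) :=
  closure [set x | f x != 0].

Definition ediam (R : realType) (A : set (R * R)) : \bar R :=
  maxe 0%E (ereal_sup [set (enorm (x - y))%:E | x in A & y in A]).

(* One-dimensional Hausdorff measure, i.e. arc length on Lipschitz curves. *)
Definition hausdorff1 (R : realType) (A : set (R * R)) : \bar R :=
  ereal_sup [set
    ereal_inf [set (\sum_(0 <= i <oo) ediam (U i))%E | U in
      [set U : nat -> set (R * R) | A `<=` \bigcup_i U i /\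
         forall i, (ediam (U i) <= delta%:E)%E]]
    | delta in [set delta : R | 0 < delta]].

(* Near each boundary point x0, in some orthonormal frame (e, e'), the set is
   the strict subgraph of a Lipschitz function. *)
Definition lipschitz_domain (R : realType) (O : set (R * R)) : Prop :=
  [/\ open O, connected O, O !=set0 &
   forall x0, bd O x0 ->
     exists (e e' : R * R) (r h : R) (gamma : R -> R),
       [/\ [/\ enorm e = 1, enorm e' = 1 & dot2 e e' = 0],
           0 < r, 0 < h, [lipschitz gamma s | s in setT] &
           forall s t, `|s| < r -> `|t| < h ->
             O (x0 + s *: e + t *: e') <-> t < gamma s]].

(* A closed non-degenerate curved piece: an arc, i.e. a homeomorphic image of
   [0, 1]. *)
Definition arc_of (R : realType) (B A : set (R * R)) : Prop :=
  A `<=` B /\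
  exists c : R -> R * R,
    [/\ {within `[0, 1], continuous c},
        {in `[0, 1] &, injective c} &
        A = c @` `[0, 1] ].

Definition regular_set (R : realType) (O Gamma : set (R * R)) : Prop :=
  let Gamma0 := bd O `\` Gamma in
  [/\ bounded_set O /\ lipschitz_domain O,
      exists2 U, open U & Gamma = bd O `&` U,
      (0 < hausdorff1 Gamma0)%E &
      exists (n : nat) (A : 'I_n -> set (R * R)),
        (forall i, arc_of (bd O) (A i)) /\ Gamma0 = \bigcup_i A i].

Definition Xi (R : realType) (D : set (R * R))
    (OG : set (R * R) * set (R * R)) : Prop :=
  [/\ OG.1 `<=` D, OG.2 `<=` bd OG.1 & regular_set OG.1 OG.2].

(* Elements of Sobolev spaces are represented by functions on the whole plane
   whose values outside O are irrelevant. *)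

Definition loc_integrable (R : realType) (O : set (R * R)) (u : R * R -> R)
    : Prop :=
  forall C, compact C -> C `<=` O -> (mu2 R).-integrable C (EFin \o u).

Definition test_fun (R : realType) (O : set (R * R)) (phi : R * R -> R)
    : Prop :=
  [/\ smooth phi, compact (supp phi) & supp phi `<=` O].

Definition weak_grad (R : realType) (O : set (R * R)) (u : R * R -> R)
    (g : R * R -> R * R) : Prop :=
  [/\ loc_integrable O u,
      loc_integrable O (fun x => (g x).1),
      loc_integrable O (fun x => (g x).2) &
      forall phi, test_fun O phi ->
        (\int[mu2 R]_(x in O) (u x * 'D_((1, 0) : R * R) phi x)) =
          - (\int[mu2 R]_(x in O) ((g x).1 * phi x)) /\
        (\int[mu2 R]_(x in O) (u x * 'D_((0, 1) : R * R) phi x)) =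
          - (\int[mu2 R]_(x in O) ((g x).2 * phi x))].

(* A chosen version of the weak gradient, unique almost everywhere on O. *)
Definition grad (R : realType) (O : set (R * R)) (u : R * R -> R)
    : R * R -> R * R :=
  xget (fun=> 0) [set g | weak_grad O u g].

Definition Lop (R : realType) (O : set (R * R)) (u : R * R -> R) (x : R * R)
    : R * (R * R) := (u x, grad O u x).

Definition Lp (R : realType) (p : R) (O : set (R * R)) (u : R * R -> R)
    : Prop := u \_ O \in Lfun (mu2 R) p%:E.

Definition W1 (R : realType) (p : R) (O : set (R * R)) (u : R * R -> R)
    : Prop :=
  [/\ Lp p O u, weak_grad O u (grad O u),
      Lp p O (fun x => (grad O u x).1) & Lp p O (fun x => (grad O u x).2)].

Definition W1norm (R : realType) (p : R) (O : set (R * R)) (u : R * R -> R)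
    : \bar R :=
  Lnorm (mu2 R) p%:E (EFin \o ((fun x => enorm3 (Lop O u x)) \_ O)).

Definition W1G (R : realType) (O Gamma : set (R * R)) (p : R)
    (u : R * R -> R) : Prop :=
  W1 p O u /\
  forall eps : R, 0 < eps -> exists f : R * R -> R,
    [/\ smooth f, supp f `&` (bd O `\` Gamma) = set0 &
        (W1norm p O (fun x => u x - f x)%R < eps%:E)%E].

Definition conj_exp (R : realType) (p : R) : R := p / (p - 1).

(* Membership in, and norm of, W^{-1}_{Gamma,p}(O), the dual of
   W^1_{Gamma,p'}(O).  Boundedness makes a functional independent of the
   representative. *)
Definition dual_W1G (R : realType) (O Gamma : set (R * R)) (p : R)
    (F : (R * R -> R) -> R) : Prop :=
  (forall (a : R) v w, W1G O Gamma (conj_exp p) v ->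
     W1G O Gamma (conj_exp p) w ->
     F (fun x => a * v x + w x) = a * F v + F w) /\
  exists C : R, forall v, W1G O Gamma (conj_exp p) v ->
    (`|F v|%:E <= C%:E * W1norm (conj_exp p) O v)%E.

Definition dual_norm (R : realType) (O Gamma : set (R * R)) (p : R)
    (F : (R * R -> R) -> R) : \bar R :=
  ereal_sup [set `|F v|%:E | v in
    [set v | W1G O Gamma (conj_exp p) v /\ (W1norm (conj_exp p) O v <= 1)%E]].

Definition Jop (R : realType) (O : set (R * R)) (v w : R * R -> R) : R :=
  \int[mu2 R]_(x in O) (dot2 (grad O v x) (grad O w x) + v x * w x).

Definition Mconst (R : realType) (O Gamma : set (R * R)) (p : R) : \bar R :=
  ereal_sup [set W1norm p O v | v in
    [set v | W1G O Gamma p v /\ (dual_norm O Gamma p (Jop O v) <= 1)%E]].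

Definition Rclass (R : realType) (O Gamma : set (R * R)) (p : R) : Prop :=
  forall F, dual_W1G O Gamma p F ->
    exists2 v, W1G O Gamma p v &
      forall w, W1G O Gamma (conj_exp p) w -> Jop O v w = F w.

Definition admissible_exponent (R : realType) (O Gamma : set (R * R))
    (k K q0 : R) : Prop :=
  let m := Num.min k 1 in
  let M := Num.max K 1 in
  [/\ 2 < q0, Rclass O Gamma q0 &
      forall r, 2 <= r <= q0 ->
        (Mconst O Gamma r * (Num.sqrt (1 - m ^+ 2 / M ^+ 2))%:E < 1)%E].

Definition admissible_beta (R : realType) (beta : R -> R) (k K : R) : Prop :=
  [/\ Ck 1 beta,
      exists bmin bmax : R,
        [/\ 0 < bmin, 0 < bmax & forall x, bmin <= beta x <= bmax],
      forall x y, 0 <= (beta x - beta y) * (x - y),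
      0 < k /\ 0 < K &
      forall eta p : R * R,
        k * enorm eta ^+ 2 <=
          beta (enorm p ^+ 2) * enorm eta ^+ 2 +
            2 * derive1 beta (enorm p ^+ 2) * `|dot2 p eta| ^+ 2
          <= K * enorm eta ^+ 2].

Definition gradPsi (R : realType) (Psi : R * R -> R -> R) (y : R * R) (z : R)
    : R * R :=
  ('D_((1, 0) : R * R) (fun y => Psi y z) y,
   'D_((0, 1) : R * R) (fun y => Psi y z) y).
Definition dPsi (R : realType) (Psi : R * R -> R -> R) (y : R * R) (z : R)
    : R := derive1 (Psi y) z.

Definition afun (R : realType) (beta : R -> R) (zeta : R * (R * R))
    : R * (R * R) := (zeta.1, beta (enorm zeta.2 ^+ 2) *: zeta.2).

(* [b(x,u)], as a linear map on the three-dimensional space. *)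
Definition bfun (R : realType) (O : set (R * R)) (beta : R -> R)
    (u : R * R -> R) (x : R * R) : R * (R * R) -> R * (R * R) :=
  'd (afun beta) (Lop O u x).

(* The representative of u is the one that is continuous on the closure. *)
Definition is_state (R : realType) (O Gamma : set (R * R)) (beta : R -> R)
    (f : R * R -> R) (q : R) (u : R * R -> R) : Prop :=
  [/\ W1G O Gamma q u, {within closure O, continuous u} &
      forall phi, W1G O Gamma (conj_exp q) phi ->
        (\int[mu2 R]_(x in O)
          (beta (enorm (grad O u x) ^+ 2) * dot2 (grad O u x) (grad O phi x)
           + u x * phi x)) =
        (\int[mu2 R]_(x in O) (f x * phi x))].

Definition is_adjoint (R : realType) (O Gamma : set (R * R)) (beta : R -> R)
    (Psi : R * R -> R -> R) (q : R) (u : R * R -> R) (y : R * R)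
    (p : R * R -> R) : Prop :=
  W1G O Gamma (conj_exp q) p /\
  forall phi, W1G O Gamma q phi -> {within closure O, continuous phi} ->
    (\int[mu2 R]_(x in O) dot3 (bfun O beta u x (Lop O p x)) (Lop O phi x)) =
    - dPsi Psi y (u y) * phi y.

Definition Jinf (R : realType) (O : set (R * R)) (Psi : R * R -> R -> R)
    (u : R * R -> R) : R := sup [set Psi x (u x) | x in closure O].

Definition Rset (R : realType) (O : set (R * R)) (Psi : R * R -> R -> R)
    (u : R * R -> R) : set (R * R) :=
  [set x | closure O x /\ Psi x (u x) = Jinf O Psi u].

Definition S1 (R : realType) (O : set (R * R)) (beta : R -> R)
    (f u p : R * R -> R) (x : R * R) : 'M[R]_2 :=
  let gu := grad O u x in
  let gp := grad O p x in
  let b := beta (enorm gu ^+ 2) in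
  let b' := derive1 beta (enorm gu ^+ 2) in
  (b * dot2 gu gp + u x * p x - f x * p x)%:M
  - b *: (tensor gu gp + tensor gp gu)
  - (2 * b' * dot2 gu gp) *: tensor gu gu.

Definition S0 (R : realType) (D : set (R * R)) (f p : R * R -> R) (x : R * R)
    : R * R := - (p x *: grad D f x).

(* Jacobian of a Lipschitz field; by Rademacher's theorem the weak derivatives
   are the pointwise ones almost everywhere. *)
Definition jacob (R : realType) (O : set (R * R)) (X : R * R -> R * R)
    (x : R * R) : 'M[R]_2 :=
  \matrix_(i, j) coord2 (grad O (fun z => coord2 (X z) i) x) j.

Definition dj (R : realType) (D O : set (R * R)) (beta : R -> R)
    (f : R * R -> R) (Psi : R * R -> R -> R) (u p : R * R -> R) (y : R * R)
    (X : R * R -> R * R) : R :=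
  (\int[mu2 R]_(x in O)
    (ddot (S1 O beta f u p x) (jacob O X x) + dot2 (S0 D f p x) (X x)))
  + dot2 (X y) (gradPsi Psi y (u y)).

(* [V] with inner product [ip] is a real Hilbert space, contained through the
   injection [iota] in the Lipschitz fields on the closure of D vanishing on
   its boundary, with continuous point evaluations. *)
Definition hilbert_fields (R : realType) (D : set (R * R))
    (V : completeNormedModType R) (ip : {dot V for idfun})
    (iota : {linear V -> (R * R -> R * R)}) : Prop :=
  [/\ forall X : V, `|X| ^+ 2 = ip X X,
      forall X Y : V, {in closure D, iota X =1 iota Y} -> X = Y,
      forall X : V, [lipschitz iota X x | x in closure D],
      forall (X : V) x, bd D x -> iota X x = 0 &
      forall (a y : R * R), closure D y ->
        continuous (fun X : V => dot2 a (iota X y))].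

(* Maxima and minima are written as extended-real suprema and infima, which
   have the same value whenever the extremum is attained. *)
Definition dJinf (R : realType) (V : completeNormedModType R)
    (ip : {dot V for idfun}) (S : set (R * R)) (G : R * R -> V) (X : V)
    : \bar R := ereal_sup [set (ip (G y) X)%:E | y in S].

Definition psi (R : realType) (V : completeNormedModType R)
    (ip : {dot V for idfun}) (H : set V) : \bar R :=
  ereal_inf [set ereal_sup [set (ip Z X)%:E | Z in H]
             | X in [set X : V | `|X| = 1]].

Definition steepest_descent (R : realType) (V : completeNormedModType R)
    (dJ : V -> \bar R) (g : V) : Prop :=
  `|g| = 1 /\ forall phi : V, `|phi| = 1 -> (dJ g <= dJ phi)%E.

Definition convex_hull (R : realType) (V : lmodType R) (A : set V) : set V :=
  [set z | exists (n : nat) (c : 'I_n -> R) (x : 'I_n -> V),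
     [/\ forall i, 0 <= c i, \sum_i c i = 1, forall i, A (x i) &
         z = \sum_i c i *: x i]].

Definition closest_point (R : realType) (V : normedModType R) (C : set V) (x0 : V)
    : V :=
  xget 0 [set z | C z /\ forall w, C w -> `|z - x0| <= `|w - x0|].

(* Main.v *)
Require Import Defs.
From HB Require Import structures.
From mathcomp Require Import all_boot all_order all_algebra.
From mathcomp Require Import all_classical all_reals all_analysis.
From mathcomp Require Import lra.

Set Implicit Arguments.
Unset Strict Implicit.
Unset Printing Implicit Defensive.

Import Order.TTheory GRing.Theory Num.Theory numFieldNormedType.Exports.
Local Open Scope classical_set_scope.
Local Open Scope ring_scope.

(** The derivative in a direction X is the support function of the set H of
gradients, sup over Z in H of (Z, X).  A support function sees only the closed
convex hull of its set, so everything is decided by the element Zhat of least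
norm of that hull.

The variational inequality |Zhat|^2 <= (Zhat, Z), valid for all Z in the hull
([closest_point0P]), bounds the support function at g = - Zhat / |Zhat| from
above by - |Zhat|.  Conversely Zhat itself lies in the hull, so at any unit
vector X the support function is at least (Zhat, X)
([ip_closure_convex_hull_le_support]), hence at least - |Zhat| by
Cauchy-Schwarz.  So g is optimal, and another optimal X attains equality in
Cauchy-Schwarz, which forces X = g ([steepest_descent_support]).

The hypothesis psi < 0 is what makes Zhat nonzero: if 0 were in the closed
hull, the support function would be nonnegative in every direction.  The hull
is nonempty because the continuous function x |-> Psi(x, u(x)) attains its
maximum on the compact closure of Omega ([Rset_nonempty]); over an empty set
the supremum would be -oo in every direction and uniqueness would fail. *)

(** * Inner products *)

Lemma ipC (R : realType) (V : completeNormedModType R) (ip : {dot V for idfun})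
  (X Y : V) : ip X Y = ip Y X.
Proof. by rewrite hermC expr0 mul1r. Qed.

Lemma sqr_normD (R : realType) (V : completeNormedModType R)
  (ip : {dot V for idfun}) :
  (forall X : V, `|X| ^+ 2 = ip X X) ->
  forall X Y, `|X + Y| ^+ 2 = `|X| ^+ 2 + 2 * ip X Y + `|Y| ^+ 2.
Proof.
move=> ipE X Y; rewrite !ipE linearDl !linearDr /= (ipC ip Y X); lra.
Qed.

(** Cauchy-Schwarz, read off from the triangle inequality: expand both sides of
|X + Y|^2 <= (|X| + |Y|)^2. *)
Lemma ip_le_norm (R : realType) (V : completeNormedModType R)
  (ip : {dot V for idfun}) :
  (forall X : V, `|X| ^+ 2 = ip X X) ->
  forall X Y, ip X Y <= `|X| * `|Y|.
Proof.
move=> ipE X Y.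
have : `|X + Y| ^+ 2 <= (`|X| + `|Y|) ^+ 2.
  by rewrite lerXn2r ?nnegrE ?addr_ge0 ?ler_normD.
rewrite (sqr_normD ipE); nra.
Qed.

(** * Convex sets and closed convex hulls *)

(** Weights in [convex_set] live in a subtype of the scalars; this form takes a
plain scalar with two inequalities. *)
Lemma convex_setP (R : realType) (V : lmodType R) (A : set V) :
  (forall x y t, A x -> A y -> 0 <= t -> t <= 1 ->
     A (t *: x + (1 - t) *: y)) <-> convex_set A.
Proof.
split=> [cA x y t /set_mem Ax /set_mem Ay | cA x y t Ax Ay t0 t1].
  by apply/mem_set/cA.
exact: set_mem (cA x y (Itv01 t0 t1) (mem_set Ax) (mem_set Ay)).
Qed.

Lemma closure_normP (R : realType) (V : normedModType R) (A : set V) x :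
  closure A x <-> forall e : R, 0 < e -> exists2 y, A y & `|x - y| < e.
Proof.
split=> [cA e e0 | h B /nbhs_ballP[e /= e0 eB]].
  have [y [Ay]] := cA _ (nbhsx_ballx x e e0).
  by rewrite -ball_normE /=; exists y.
have [y Ay xy] := h e e0; exists y; split=> //.
by apply: eB; rewrite -ball_normE.
Qed.

Lemma convex_set_closure (R : realType) (V : normedModType R) (A : set V) :
  convex_set A -> convex_set (closure A : set V).
Proof.
move=> /convex_setP cA; apply/convex_setP => x y t /closure_normP Ax.
move=> /closure_normP Ay t0 t1; apply/closure_normP => e e0.
have e20 : 0 < e / 2 by lra.
have [x' Ax' xx'] := Ax _ e20; have [y' Ay' yy'] := Ay _ e20.
exists (t *: x' + (1 - t) *: y'); first exact: cA.
rewrite opprD addrACA -!scalerBr (le_lt_trans (ler_normD _ _))//.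
rewrite !normrZ !ger0_norm ?subr_ge0//; nra.
Qed.

(** Two convex combinations, with n and m terms, are glued into one with n + m
terms by splitting its index type. *)
Lemma convex_set_convex_hull (R : realType) (V : lmodType R) (A : set V) :
  convex_set (convex_hull A).
Proof.
apply/convex_setP => _ _ t [n [c [x [c0 c1 Ax ->]]]] [m [d [y [d0 d1 Ay ->]]]].
move=> t0 t1; exists (n + m)%N.
exists (fun i : 'I_(n + m) =>
  match fintype.split i with inl j => t * c j | inr j => (1 - t) * d j end).
exists (fun i : 'I_(n + m) =>
  match fintype.split i with inl j => x j | inr j => y j end).
have El j : fintype.split (lshift m j) = inl j by exact: (unsplitK (inl j)).
have Er j : fintype.split (rshift n j) = inr j by exact: (unsplitK (inr j)).
split=> [i||i|].
- by case: fintype.split => j; rewrite mulr_ge0 ?subr_ge0.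
- rewrite big_split_ord /=.
  under eq_bigr do rewrite El.
  under [X in _ + X]eq_bigr do rewrite Er.
  by rewrite -!mulr_sumr c1 d1; lra.
- by case: fintype.split.
- rewrite big_split_ord /= !scaler_sumr.
  congr (_ + _); apply: eq_bigr => i _.
    by rewrite El scalerA.
  by rewrite Er scalerA.
Qed.

Lemma subset_convex_hull (R : realType) (V : lmodType R) (A : set V) :
  A `<=` convex_hull A.
Proof.
move=> x Ax; exists 1%N, (fun=> 1), (fun=> x); split=> //.
  by rewrite big_ord1.
by rewrite big_ord1 scale1r.
Qed.

(** * Projection of the origin *)

(** Almost minimal elements are close to each other: if x and y have norm at
most d + e, where d is the infimum of the norms, their midpoint still has norm
at least d, so the parallelogram identity gives |x - y|^2 <= 8 d e + 4 e^2.
Hence the sets of almost minimal elements generate a Cauchy filter, whose limit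
is the minimizer. *)
Lemma exists_min_norm (R : realType) (V : completeNormedModType R)
  (ip : {dot V for idfun}) (C : set V) :
  (forall X : V, `|X| ^+ 2 = ip X X) ->
  C !=set0 -> closed C -> convex_set C ->
  exists2 z, C z & forall w, C w -> `|z| <= `|w|.
Proof.
move=> ipE [x0 Cx0] clC /convex_setP cC.
pose N : set R := [set `|x| | x in C].
have N0 : has_inf N by split; [exists `|x0|, x0 | exists 0 => _ [x _ <-]].
pose d := inf N.
have d_le x : C x -> d <= `|x| by move=> Cx; apply: (ge_inf N0.2); exists x.
have d0 : 0 <= d by apply: lb_le_inf N0.1 _ => _ [x _ <-].
pose F := filter_from [set e : R | 0 < e] (fun e => [set x | C x /\ `|x| < d + e]).
have FF : ProperFilter F.
  apply: filter_from_proper.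
    apply: filter_from_filter; first by exists 1 => /=.
    move=> e e' /= e0 e'0; exists (Num.min e e') => /=.
      by rewrite lt_min e0.
    move=> x /= [Cx]; rewrite -ltrBlDl lt_min => /andP[h1 h2].
    by split; split=> //; rewrite -ltrBlDl.
  move=> e /= e0; have [_ [x Cx <-] xe] := inf_adherent e0 N0.
  by exists x.
have Fsmall e : 0 < e -> F [set x | C x /\ `|x| < d + e] by move=> e0; exists e.
have : cvg F.
  apply: cauchy_cvg; apply: cauchy_exP => eps eps0.
  (* As e <= 1, the bound 8 d e + 4 e^2 is below e (8 d + 5) <= eps^2. *)
  pose e := Num.min 1 (eps ^+ 2 / (8 * d + 5)).
  have e0 : 0 < e by rewrite lt_min ltr01 divr_gt0 ?exprn_gt0//; lra.
  have e1 : e <= 1 by rewrite ge_min lexx.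
  have ee : e * (8 * d + 5) <= eps ^+ 2.
    by rewrite -ler_pdivlMr ?ge_min ?lexx ?orbT//; lra.
  have [x [Cx xe]] := filter_ex (Fsmall _ e0).
  exists x; apply: filterS (Fsmall _ e0) => y [Cy ye].
  rewrite -ball_normE /= -(@ltr_pXn2r _ 2) ?nnegrE// ?(ltW eps0)//.
  have := d_le _ (cC x y (1 / 2) Cx Cy ltac:(lra) ltac:(lra)).
  have -> : (1 - 1 / 2 : R) = 1 / 2 by lra.
  rewrite -scalerDr normrZ ger0_norm; last by lra.
  move=> dxy; have {}dxy : (2 * d) ^+ 2 <= `|x + y| ^+ 2.
    by rewrite lerXn2r ?nnegrE//; lra.
  rewrite (sqr_normD ipE) in dxy.
  rewrite (sqr_normD ipE) linearNr normrN /=.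
  have := normr_ge0 x; have := normr_ge0 y.
  nra.
move=> /cvg_ex[z Fz].
have Cz : C z.
  apply: (@closed_cvg _ _ F _ id C clC _ z Fz).
  by apply: filterS (Fsmall 1 ltr01) => x [].
exists z => // w Cw; apply: le_trans (d_le _ Cw).
apply/ler_addgt0Pl => e e0; rewrite addrC.
apply: (@closed_cvg _ _ F _ _ _ (@closed_le R (d + e)) _ _ (cvg_norm Fz)).
by apply: filterS (Fsmall _ e0) => x [_ /ltW].
Qed.

(** Moving from the minimizer z towards w by a step t cannot decrease the
norm; the first-order term of |z + t (w - z)|^2 gives the inequality. *)
Lemma closest_point0P (R : realType) (V : completeNormedModType R)
  (ip : {dot V for idfun}) (C : set V) :
  (forall X : V, `|X| ^+ 2 = ip X X) ->
  C !=set0 -> closed C -> convex_set C ->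
  let z := closest_point C 0 in
  C z /\ forall w, C w -> `|z| ^+ 2 <= ip z w.
Proof.
move=> ipE C0 clC cC z.
have [Cz zmin] : C z /\ forall w, C w -> `|z - 0| <= `|w - 0|.
  apply: (@xgetPex _ 0 [set z | C z /\ forall w, C w -> `|z - 0| <= `|w - 0|]).
  have [y Cy ymin] := exists_min_norm ipE C0 clC cC.
  by exists y; split=> // w Cw; rewrite !subr0 ymin.
split=> // w Cw; move/convex_setP in cC.
have key t : 0 <= t -> t <= 1 ->
    0 <= t * (2 * (ip z w - `|z| ^+ 2) + t * `|w - z| ^+ 2).
  move=> t0 t1; have := zmin _ (cC w z t Cw Cz t0 t1).
  have -> : t *: w + (1 - t) *: z = z + t *: (w - z).
    by rewrite scalerBl scale1r scalerBr addrCA.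
  rewrite !subr0 -(@ler_pXn2r _ 2) ?nnegrE// (sqr_normD ipE).
  rewrite linearZr_LR /= linearBr /= -ipE normrZ (ger0_norm t0).
  lra.
rewrite -subr_ge0 leNgt; apply/negP => lt0.
set a := ip z w - _ in key lt0; set b := `|w - z| ^+ 2 in key.
have b0 : 0 <= b by rewrite exprn_ge0.
(* If the first-order coefficient a were negative, this step would be short
   enough for the second-order term t b not to compensate 2 a. *)
pose t := Num.min 1 (- a / (b + 1)).
have t0 : 0 < t by rewrite lt_min ltr01 divr_gt0//; lra.
have t1 : t <= 1 by rewrite ge_min lexx.
have tb : t * (b + 1) <= - a.
  by rewrite -ler_pdivlMr ?ge_min ?lexx ?orbT//; lra.
have := key t (ltW t0) t1; rewrite pmulr_rge0//; nra.
Qed.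

(** * Support functions and steepest descent *)

(** A closed half-space is closed and convex, so it contains the closed convex
hull of each of its subsets. *)
Lemma ip_closure_convex_hull_le (R : realType) (V : completeNormedModType R)
  (ip : {dot V for idfun}) (H : set V) X c :
  (forall X : V, `|X| ^+ 2 = ip X X) ->
  (forall Z, H Z -> ip Z X <= c) ->
  forall Z, closure (convex_hull H) Z -> ip Z X <= c.
Proof.
move=> ipE Hc Z /closure_normP clZ; rewrite leNgt; apply/negP => lt.
have X1 : 0 < `|X| + 1 by rewrite ltr_wpDl.
have e0 : 0 < (ip Z X - c) / (`|X| + 1) by rewrite divr_gt0 ?subr_gt0.
have [_ [n [a [x [a0 a1 Hx ->]]]]] := clZ _ e0.
rewrite ltr_pdivlMr// => near; set W := \sum_i _ in near.
have W_le : ip W X <= c.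
  rewrite /W linear_sumlz -[c]mul1r -a1 mulr_suml.
  by apply: ler_sum => i _; rewrite linearZl_LR /= ler_wpM2l ?Hc.
have := ip_le_norm ipE (Z - W) X; rewrite linearBl /=.
have := normr_ge0 (Z - W); have := normr_ge0 X; nra.
Qed.

Definition support_fun (R : realType) (V : completeNormedModType R)
  (ip : {dot V for idfun}) (H : set V) (X : V) : \bar R :=
  ereal_sup [set (ip Z X)%:E | Z in H].

(** Every closed half-space with normal X that contains H contains its closed
convex hull, so passing to the hull does not increase the support function.
When the support function is +oo this is trivial, and when it is -oo the
half-spaces of all levels contain H, which is impossible once the hull has an
element. *)
Lemma ip_closure_convex_hull_le_support (R : realType)
  (V : completeNormedModType R) (ip : {dot V for idfun}) (H : set V) X Z :
  (forall X : V, `|X| ^+ 2 = ip X X) ->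
  closure (convex_hull H) Z -> ((ip Z X)%:E <= support_fun ip H X)%E.
Proof.
move=> ipE clZ.
suff h c : (support_fun ip H X <= c%:E)%E -> ip Z X <= c.
  case E : (support_fun _ _ _) => [s| |]; rewrite ?leey//.
    by rewrite lee_fin; apply: h; rewrite E.
  have : ip Z X <= ip Z X - 1 by apply: h; rewrite E leNye.
  by rewrite lerBrDl gerDr ler10.
move=> Hc; apply: (ip_closure_convex_hull_le (H := H) ipE _ clZ) => Y HY.
by rewrite -lee_fin; apply: le_trans Hc; apply: ereal_sup_ubound; exists Y.
Qed.

(** The geometric content of the theorem, for an arbitrary nonempty set H, which
may be unbounded: suprema are extended reals. *)
Lemma steepest_descent_support (R : realType) (V : completeNormedModType R)
  (ip : {dot V for idfun}) (H : set V) :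
  (forall X : V, `|X| ^+ 2 = ip X X) ->
  H !=set0 -> (psi ip H < 0)%E ->
  let Z := closest_point (closure (convex_hull H)) 0 in
  let g := - (`|Z|^-1 *: Z) in
  steepest_descent (support_fun ip H) g /\
  forall g', steepest_descent (support_fun ip H) g' -> g' = g.
Proof.
move=> ipE [Z0 HZ0] psi0 Z g.
have subH : H `<=` closure (convex_hull H).
  by apply: subset_trans (@subset_closure _ _); exact: subset_convex_hull.
have [clZ Zmin] : closure (convex_hull H) Z /\
    forall w, closure (convex_hull H) w -> `|Z| ^+ 2 <= ip Z w.
  apply: (closest_point0P ipE) => //.
  - by exists Z0; exact: subH.
  - exact: closed_closure.
  - exact/convex_set_closure/convex_set_convex_hull.
have Zpos : 0 < `|Z|.
  rewrite normr_gt0; apply: contraTneq psi0 => Z_0; rewrite -leNgt.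
  apply/ereal_infP => _ [X _ <-].
  have := ip_closure_convex_hull_le_support X ipE clZ.
  by rewrite Z_0 linear0l.
have norm_g : `|g| = 1.
  by rewrite normrN normrZ ger0_norm ?invr_ge0// mulVf ?gt_eqF.
have ipg X : ip X g = - (`|Z|^-1 * ip Z X).
  by rewrite linearNr /= linearZr_LR /= (ipC ip X).
have dJg : (support_fun ip H g <= (- `|Z|)%:E)%E.
  apply: ge_ereal_sup => _ [X HX <-]; rewrite lee_fin ipg lerN2.
  by rewrite ler_pdivlMl// -expr2; apply/Zmin/subH.
split=> [|g' [norm_g' g'min]].
  split=> // X normX; apply: le_trans dJg _.
  apply: le_trans (ip_closure_convex_hull_le_support X ipE clZ).
  rewrite lee_fin lerNl -linearNr /= (le_trans (ip_le_norm ipE _ _))//.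
  by rewrite normrN normX mulr1.
(* Another minimizer satisfies (Z, g') <= - |Z|, that is (g', g) >= 1, which for
   two unit vectors means |g' - g|^2 <= 0. *)
have : ip Z g' <= - `|Z|.
  rewrite -lee_fin; apply: le_trans dJg; apply: le_trans (g'min _ norm_g).
  exact: ip_closure_convex_hull_le_support.
move=> ipZg'; have : 1 <= ip g' g.
  by rewrite ipg lerNr ler_pdivrMl// mulrN1.
move=> h; apply/eqP; rewrite -subr_eq0 -normr_eq0 -sqrf_eq0 eq_le sqr_ge0 andbT.
rewrite (sqr_normD ipE) linearNr /= normrN norm_g norm_g'; lra.
Qed.

(** * Existence of a maximum point *)

(** The norm of the plane is the max norm, so a bounded set lies in a product of
two segments. *)
Lemma compact_closure_bounded (R : realType) (A : set (R * R)) :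
  bounded_set A -> compact (closure A).
Proof.
(* Boundedness provides a bound by every number strictly above M0. *)
move=> [M0 [_ AM0]]; have AM := AM0 (M0 + 1) (ltr_pwDr ltr01 (lexx _)).
set M := M0 + 1 in AM; rewrite -precompactE.
apply: (@precompact_subset _ _ (`[- M, M] `*` `[- M, M])).
  move=> x /AM /=; rewrite prod_normE /= ge_max !in_itv /= !ler_norml.
  by move=> /andP[].
apply: compact_precompact; first exact: norm_hausdorff.
by apply: compact_setX; exact: segment_compact.
Qed.

Lemma Rset_nonempty (R : realType) (O : set (R * R)) (Psi : R * R -> R -> R)
  (u : R * R -> R) :
  O !=set0 -> bounded_set O -> {within closure O, continuous u} ->
  continuous (fun z : (R * R) * R => Psi z.1 z.2) ->
  Rset O Psi u !=set0.
Proof.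
move=> O0 bO cu cPsi.
have clO0 : closure O !=set0 by apply: subset_nonempty O0; exact: subset_closure.
have cPu : {within closure O, continuous (fun x => Psi x (u x))}.
  apply/subspace_continuousP => x Ox.
  apply: (@cvg_comp _ _ _ (fun x => (x, u x)) (fun z => Psi z.1 z.2) _ (nbhs (x, u x))).
    apply: (@cvg_pair _ _ _ _ (nbhs x) (nbhs (u x))); first exact: cvg_within.
    by move/subspace_continuousP : cu; exact.
  exact: (cPsi (x, u x)).
have [c /set_mem Oc cmax] := compact_EVT_max clO0 (compact_closure_bounded bO) cPu.
exists c; split=> //; apply/eqP; rewrite eq_le /Jinf; apply/andP; split.
  apply: ub_le_sup; last by exists c.
  by exists (Psi c (u c)) => _ [x Ox <-]; apply/cmax/mem_set.
apply: ge_sup; first by exists (Psi c (u c)), c.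
by move=> _ [x Ox <-]; apply/cmax/mem_set.
Qed.

Theorem theorem3p10 (R : realType) (D : set (R * R)) (beta : R -> R) (k K : R)
  (f : R * R -> R) (Psi : R * R -> R -> R)
  (Omega Gamma : set (R * R)) (q0 q : R)
  (u : R * R -> R) (p : R * R -> R * R -> R)
  (V : completeNormedModType R) (ip : {dot V for idfun})
  (iota : {linear V -> (R * R -> R * R)}) (nablaj : R * R -> V) :
  open D -> bounded_set D ->
  admissible_beta beta k K ->
  Ck 1 (fun z : (R * R) * R => Psi z.1 z.2) ->
  Xi D (Omega, Gamma) ->
  admissible_exponent Omega Gamma k K q0 ->
  2 < q < q0 ->
  W1 q D f ->
  is_state Omega Gamma beta f q u ->
  (forall y, closure Omega y -> is_adjoint Omega Gamma beta Psi q u y (p y)) ->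
  hilbert_fields D ip iota ->
  (forall y, closure Omega y -> forall phi : V,
     ip (nablaj y) phi = dj D Omega beta f Psi u (p y) y (iota phi)) ->
  let Rmax := Rset Omega Psi u in
  let H := nablaj @` Rmax in
  let Lbar := closure (convex_hull H) in
  let dJ := dJinf ip Rmax nablaj in
  (psi ip H < 0)%E ->
  let Zhat := closest_point Lbar 0 in
  let g := - (`|Zhat|^-1 *: Zhat) in
  steepest_descent dJ g /\ forall g', steepest_descent dJ g' -> g' = g.
Proof.
move=> _ _ _ CPsi XiO _ _ _ [_ cu _] _ [ipE _ _ _ _] _ Rmax H Lbar dJ psi0 Zhat g.
have dJE : dJ = support_fun ip H.
  by apply/funext => X; rewrite /dJ /dJinf /support_fun /H image_comp.
have [_ _ [[/= bO [_ _ O0 _]] _ _ _]] := XiO.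
have cPsi : continuous (fun z : (R * R) * R => Psi z.1 z.2).
  by move=> z; apply/differentiable_continuous/CPsi.1.
have H0 : H !=set0 by apply: image_nonempty; exact: Rset_nonempty.
by rewrite dJE; exact: steepest_descent_support.
Qed.
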